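(* Let $(A,(\cdot,\cdot),R)$ be a tame irreducible affine reflection system of type $A_1$, and let $\Pi\subseteq R^\times$ be a reflectable set for $R$. Then the Weyl group $\mathcal{W}$ of $R$ is isomorphic to the group $G$ defined by generators: $x_\alpha$, $\alpha\in\Pi$; relations: $x_{\alpha_1}\cdots x_{\alpha_k}=1$ for all $(\alpha_1,\ldots,\alpha_k)\in\mathrm{Alt}(\Pi)$.
   Context: Let $A$ be an (arbitrary) abelian group with a nontrivial symmetric bi-homomorphism $(\cdot,\cdot):A\times A\to\mathbb{Q}$ that is positive semidefinite, i.e. $(\alpha,\alpha)\ge 0$ for all $\alpha$. Its radical is $A^0=\{\alpha\in A:(\alpha,A)=0\}$. For $B\subseteq A$ put $B^\times=B\setminus A^0$, $B^0=B\cap A^0$. Put $(\beta,\alpha^\vee)=2(\beta,\alpha)/(\alpha,\alpha)$ if $(\alpha,\alpha)\neq0$ and $(\beta,\alpha^\vee)=0$ otherwise. A subset $R\subseteq A$ is an affine reflection system if (R1) $R=-R$; (R2) $R$ generates $A$; (R3) for $\alpha\in R^\times$, $\beta\in R$ there are $d,u\in\mathbb{Z}_{\ge0}$ with $(\beta+\mathbb{Z}\alpha)\cap R=\{\beta-d\alpha,\dots,\beta+u\alpha\}$ and $d-u=(\beta,\alpha^\vee)$. It is irreducible if $R^\times$ is not a disjoint union of two nonempty orthogonal subsets, and tame if $R^0\subseteq R^\times-R^\times$. Its type is the type of its image in $A/A^0$, which is a locally finite root system; type $A_1$ means that this image is $\{0,\pm\bar\epsilon\}$. For $R$ tame irreducible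 of type $A_1$ it is known that $R=(S+S)\cup(\dot R+S)$ with $\dot R=\{0,\pm\epsilon\}$ and $S\subseteq R^0$ satisfying $0\in S$, $S\pm2S\subseteq S$, $\langle S\rangle=A^0$, and $A=\mathbb{Z}\epsilon\oplus A^0$. Fix such $\epsilon$, $S$, and normalize the form so that $(\epsilon,\epsilon)=2$. Every $\alpha\in A$ is uniquely $\alpha=\mathrm{sgn}(\alpha)\epsilon+p(\alpha)$ with $\mathrm{sgn}(\alpha)\in\mathbb{Z}$, $p(\alpha)\in A^0$. For $\alpha\in A$, $w_\alpha\in\mathrm{Aut}(A)$ is $w_\alpha(\beta)=\beta-(\beta,\alpha^\vee)\alpha$. For $P\subseteq R$, $\mathcal{W}_P$ is the subgroup of $\mathrm{Aut}(A)$ generated by $w_\alpha$, $\alpha\in P$; the Weyl group of $R$ is $\mathcal{W}=\mathcal{W}_R$. A set $P\subseteq R^\times$ is a reflectable set if $\mathcal{W}_PP=R^\times$. For $P\subseteq R^\times$, an alternating $k$-tuple in $P$ is a $k$-tuple $(\alpha_1,\dots,\alpha_k)$ of elements of $P$ with $k$ even and $\sum_{j=1}^k(-1)^j\mathrm{sgn}(\alpha_j)p(\alpha_j)=0$; $\mathrm{Alt}(P)$ is the set of all alternating $k$-tuples in $P$ for all $k$.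
   Formalization: The formal theorem also assumes that A has no element of order 2; without this the claim fails, e.g. A=Z×Z/2, (x,y)=2x₁y₁, R={|x₁|≤1}, Π={(1,0),(1,1)}, where W has order 2 but G is the Klein four-group. *)

(* Defs.v *)
From HB Require Import structures.
From mathcomp Require Import all_boot all_order all_algebra.
From mathcomp Require Import boolp classical_sets.

Set Implicit Arguments.
Unset Strict Implicit.
Unset Printing Implicit Defensive.

Import Order.TTheory GRing.Theory Num.Theory.

Local Open Scope classical_set_scope.
Local Open Scope quotient_scope.
Local Open Scope ring_scope.

Definition zmod_gen (A : zmodType) (B : set A) : set A :=
  smallest (fun H : set A => zmod_closed [in H]) B.

Definition gen (G : groupType) (B : set G) : set G :=
  smallest (fun H : set G => group_closed [in H]) B.

Lemma gen_group_closed (G : groupType) (B : set G) : group_closed [in gen B].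
Proof.
split; first by apply/mem_set => H [[]]; rewrite inE.
move=> x y /set_mem xB /set_mem yB; apply/mem_set => H HB.
by apply/set_mem; apply: HB.1.2; apply/mem_set; [apply: xB | apply: yB].
Qed.

Record gen_group (G : groupType) (B : set G) : Type := GenGroup {
  gen_val :> G;
  gen_valP : gen_val \in gen B
}.

Section GenGroup.
Variables (G : groupType) (B : set G).
HB.instance Definition _ := [isSub of gen_group B for @gen_val G B].
HB.instance Definition _ := [Choice of gen_group B by <:].
HB.instance Definition _ :=
  SubChoice_isSubGroup.Build G [in gen B] (gen_group B) (gen_group_closed B).
End GenGroup.

Definition is_aut (A : zmodType) : set (A -> A) :=
  [set f | zmod_morphism f /\ bijective f].
Arguments is_aut A : clear implicits.

Record aut (A : zmodType) : Type := Aut {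
  aut_val :> A -> A;
  aut_valP : aut_val \in is_aut A
}.

Section AutGroup.
Variable A : zmodType.
Implicit Types f g h : aut A.

HB.instance Definition _ := [isSub of aut A for @aut_val A].
HB.instance Definition _ := [Choice of aut A by <:].

Lemma autP f g : f =1 g -> f = g.
Proof. by move=> fg; apply/val_inj/funext. Qed.

Lemma aut_zmod_morphism f : zmod_morphism f.
Proof. by have /set_mem[] := aut_valP f. Qed.

HB.instance Definition _ f :=
  GRing.isZmodMorphism.Build A A (aut_val f) (aut_zmod_morphism f).

Lemma aut_one_subproof : idfun \in is_aut A.
Proof. by apply/mem_set; split=> //; exists idfun. Qed.

Lemma aut_mul_subproof f g : f \o g \in is_aut A.
Proof.
apply/mem_set; split; first by move=> x y /=; rewrite !raddfB.
by apply: bij_comp; [have /set_mem[] := aut_valP f | have /set_mem[] := aut_valP g].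
Qed.

Lemma aut_inv_exists f : exists g : A -> A, cancel g f /\ cancel f g.
Proof. by have /set_mem[_ [g fK gK]] := aut_valP f; exists g. Qed.

Let inv f : A -> A := projT1 (cid (aut_inv_exists f)).
Let invK f : cancel (inv f) f. Proof. exact: (projT2 (cid (aut_inv_exists f))).1. Qed.
Let Kinv f : cancel f (inv f). Proof. exact: (projT2 (cid (aut_inv_exists f))).2. Qed.

Lemma aut_inv_subproof f : inv f \in is_aut A.
Proof.
apply/mem_set; split; last by exists f; [exact: invK | exact: Kinv].
exact: (can2_zmod_morphism (Kinv f) (invK f)).
Qed.

Definition aut_one : aut A := Aut aut_one_subproof.
Definition aut_mul f g : aut A := Aut (aut_mul_subproof f g).
Definition aut_inv f : aut A := Aut (aut_inv_subproof f).

Lemma aut_mulA : associative aut_mul. Proof. by move=> f g h; apply: autP. Qed.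
Lemma aut_mul1 : left_id aut_one aut_mul. Proof. by move=> f; apply: autP. Qed.
Lemma aut_mulr1 : right_id aut_one aut_mul. Proof. by move=> f; apply: autP. Qed.
Lemma aut_mulV : left_inverse aut_one aut_inv aut_mul.
Proof. by move=> f; apply: autP => x /=; exact: Kinv. Qed.
Lemma aut_mulrV : right_inverse aut_one aut_inv aut_mul.
Proof. by move=> f; apply: autP => x /=; exact: invK. Qed.

HB.instance Definition _ :=
  isGroup.Build (aut A) aut_mulA aut_mul1 aut_mulr1 aut_mulV aut_mulrV.

End AutGroup.

(* The letter (x, false) stands for x, the letter (x, true) for x^-1. *)
Definition word (X : Type) : Type := seq (X * bool).

Inductive word_eqv (X : Type) (rels : set (word X)) : word X -> word X -> Prop :=
| word_eqv_refl u : word_eqv rels u u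
| word_eqv_sym u v : word_eqv rels u v -> word_eqv rels v u
| word_eqv_trans u v w :
    word_eqv rels u v -> word_eqv rels v w -> word_eqv rels u w
| word_eqv_cat u u' v v' :
    word_eqv rels u u' -> word_eqv rels v v' -> word_eqv rels (u ++ v) (u' ++ v')
| word_eqv_cancel x b : word_eqv rels [:: (x, b); (x, ~~ b)] [::]
| word_eqv_rel r : rels r -> word_eqv rels r [::].

Definition word_inv (X : Type) (w : word X) : word X :=
  rev [seq (c.1, ~~ c.2) | c <- w].

Section Presentation.
Variables (X : choiceType) (rels : set (word X)).

HB.instance Definition _ := Choice.copy (word X) (seq (X * bool)).

Definition word_eqvb (u v : word X) : bool := `[< word_eqv rels u v >].

Lemma word_eqvb_equiv : equiv_class_of word_eqvb.
Proof.
split=> [u | u v | v u w].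
- exact/asboolP/word_eqv_refl.
- by apply/asboolP/asboolP; exact: word_eqv_sym.
- by move=> /asboolP uv /asboolP vw; exact/asboolP/(word_eqv_trans uv vw).
Qed.

Canonical word_equiv := EquivRelPack word_eqvb_equiv.

Definition presented : Type := {eq_quot word_equiv}.
HB.instance Definition _ := Choice.on presented.
HB.instance Definition _ := EqQuotient.on presented.

Definition presented_pi (u : word X) : presented := \pi_presented u.

Lemma presented_piP u v :
  presented_pi u = presented_pi v <-> word_eqv rels u v.
Proof.
split=> [/eqP | uv]; first by rewrite /presented_pi piE => /asboolP.
by apply/eqP; rewrite /presented_pi piE; apply/asboolP.
Qed.

Definition presented_one : presented := presented_pi [::].
Definition presented_mul (p q : presented) : presented :=
  presented_pi (repr p ++ repr q).
Definition presented_inv (p : presented) : presented :=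
  presented_pi (word_inv (repr p)).

Lemma presented_reprK (p : presented) : presented_pi (repr p) = p.
Proof. exact: reprK. Qed.

Lemma presented_repr_pi u : word_eqv rels (repr (presented_pi u)) u.
Proof. by apply/presented_piP; rewrite presented_reprK. Qed.

Lemma presented_mulE u v :
  presented_mul (presented_pi u) (presented_pi v) = presented_pi (u ++ v).
Proof. by apply/presented_piP/word_eqv_cat; exact: presented_repr_pi. Qed.

Lemma presented_piW (P : presented -> Prop) :
  (forall u, P (presented_pi u)) -> forall p, P p.
Proof. by move=> Ppi p; rewrite -(presented_reprK p). Qed.

Lemma word_invK : involutive (@word_inv X).
Proof.
move=> w; rewrite /word_inv map_rev revK -map_comp -[RHS]map_id.
by apply: eq_map => -[x b] /=; rewrite negbK.
Qed.

Lemma word_eqv_mulV w : word_eqv rels (w ++ word_inv w) [::].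
Proof.
elim: w => [|[x b] w IHw]; first exact: word_eqv_refl.
rewrite /word_inv /= rev_cons -cats1 -cat_cons catA cat_cons.
apply: (@word_eqv_trans _ _ _ ([:: (x, b)] ++ [::] ++ [:: (x, ~~ b)])).
  rewrite -[(x, b) :: _]/([:: (x, b)] ++ _) -catA.
  by apply: word_eqv_cat (word_eqv_cat IHw _); exact: word_eqv_refl.
exact: word_eqv_cancel.
Qed.

Lemma presented_mulA : associative presented_mul.
Proof.
elim/presented_piW => u; elim/presented_piW => v; elim/presented_piW => w.
by rewrite !presented_mulE catA.
Qed.

Lemma presented_mul1 : left_id presented_one presented_mul.
Proof. by elim/presented_piW => u; rewrite presented_mulE. Qed.

Lemma presented_mulr1 : right_id presented_one presented_mul.
Proof. by elim/presented_piW => u; rewrite presented_mulE cats0. Qed.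

Lemma presented_mulV : left_inverse presented_one presented_inv presented_mul.
Proof.
move=> p; rewrite -{2}(presented_reprK p) presented_mulE; apply/presented_piP.
by rewrite -{2}(word_invK (repr p)); exact: word_eqv_mulV.
Qed.

Lemma presented_mulrV : right_inverse presented_one presented_inv presented_mul.
Proof.
move=> p; rewrite -{1}(presented_reprK p) presented_mulE; apply/presented_piP.
exact: word_eqv_mulV.
Qed.

HB.instance Definition _ := isGroup.Build presented
  presented_mulA presented_mul1 presented_mulr1 presented_mulV presented_mulrV.

End Presentation.

Definition isomorphic (G H : groupType) : Prop :=
  exists f : {multiplicative G -> H}, bijective f.

Section AffineReflectionSystem.
Variables (A : zmodType) (form : A -> A -> rat).
Implicit Types (a b e : A) (B P R S : set A).

Record psd_form : Prop := PsdForm {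
  form_sym : forall a b, form a b = form b a;
  form_addl : forall a a' b, form (a + a') b = form a b + form a' b;
  form_addr : forall a b b', form a (b + b') = form a b + form a b';
  form_ge0 : forall a, 0 <= form a a;
  form_neq0 : exists a b, form a b != 0
}.

Definition radical : set A := [set a | forall b, form a b = 0].

Definition nonisotropic B : set A := B `\` radical.
Definition isotropic B : set A := B `&` radical.

Definition pairing b a : rat :=
  if form a a != 0 then 2 * form b a / form a a else 0.

Record affine_reflection_system R : Prop := AffineReflectionSystem {
  ars_opp : R = [set - a | a in R];
  ars_gen : zmod_gen R = setT;
  ars_string : forall a b, nonisotropic R a -> R b ->
    exists d u : nat,
      [set b + a *~ n | n in [set: int]] `&` R =
      [set b + a *~ n | n in [set n : int | - d%:Z <= n <= u%:Z]] /\
      d%:Q - u%:Q = pairing b a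
}.

Definition irreducible R : Prop :=
  ~ exists B C : set A,
      [/\ B !=set0, C !=set0, B `&` C = set0, nonisotropic R = B `|` C &
          forall b c, B b -> C c -> form b c = 0].

Definition tame R : Prop :=
  isotropic R `<=`
  [set x | exists a b, [/\ nonisotropic R a, nonisotropic R b & x = a - b]].

(* The element of A / radical represented by a, as a subset of A. *)
Definition rad_class a : set A := [set b | radical (b - a)].

Definition type_A1 R : Prop :=
  exists e, rad_class e <> rad_class 0 /\
    rad_class @` R = [set rad_class 0; rad_class e; rad_class (- e)].

Record A1_realization R e S : Prop := A1Realization {
  A1_sub : S `<=` isotropic R;
  A1_S0 : S 0;
  A1_S2 : forall s t, S s -> S t -> S (s + t *+ 2) /\ S (s - t *+ 2);
  A1_Sgen : zmod_gen S = radical;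
  A1_direct : forall a, exists! np : int * A, radical np.2 /\ a = e *~ np.1 + np.2;
  A1_roots : R = [set s + t | s in S & t in S] `|`
                 [set r + s | r in [set 0; e; - e] & s in S]
}.

(* When A = Z e (+) radical, coords e a is the unique such pair; otherwise it may
   be the junk value (0, 0). *)
Definition coords e a : int * A :=
  xget (0, 0) [set np | radical np.2 /\ a = e *~ np.1 + np.2].
Definition sgn e a : int := (coords e a).1.
Definition rad_part e a : A := (coords e a).2.

(* The formula for w_a preserves A only if all the (b, a^vee) are integers, as
   is the case when a lies in an affine reflection system R (see
   [reflection_root] below); outside that case the value 1 is junk. *)
Definition reflection_spec a (w : aut A) : Prop :=
  forall b, exists2 n : int, n%:Q = pairing b a & w b = b - a *~ n.
Definition reflection a : aut A := xget 1%g (reflection_spec a).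

Lemma pairingDl b b' a : psd_form ->
  pairing (b + b') a = pairing b a + pairing b' a.
Proof.
move=> Hf; rewrite /pairing; case: ifP => _; last by rewrite addr0.
by rewrite (form_addl Hf) mulrDr mulrDl.
Qed.

Lemma pairing_int R a b : psd_form -> affine_reflection_system R -> R a ->
  exists n : int, n%:Q = pairing b a.
Proof.
move=> Hf HR Ra.
have [aa0 | aaN0] := eqVneq (form a a) 0.
  by exists 0; rewrite /pairing aa0 eqxx.
have aX : nonisotropic R a by split=> // /(_ a) aa0; rewrite aa0 eqxx in aaN0.
have pair0 : pairing 0 a = 0.
  by apply: (addrI (pairing 0 a)); rewrite -pairingDl // !addr0.
pose H : set A := [set b | exists n : int, n%:Q = pairing b a].
suff: zmod_gen R `<=` H by rewrite (ars_gen HR) => /(_ b I).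
apply: smallest_sub => [|c /(ars_string HR aX)[d [u [_ Hdu]]]]; last first.
  by exists (d%:Z - u%:Z); rewrite -Hdu rmorphB.
split=> [|x y /set_mem[n xn] /set_mem[m ym]]; apply/mem_set.
  by exists 0; rewrite pair0.
exists (n - m); apply: (addIr (pairing y a)).
by rewrite -pairingDl // subrK rmorphB /= xn ym subrK.
Qed.

Lemma reflection_root R a : psd_form -> affine_reflection_system R -> R a ->
  reflection_spec a (reflection a).
Proof.
move=> Hf HR Ra.
have [f fP] := choice (fun b => pairing_int b Hf HR Ra).
pose w b := b - a *~ f b.
have fD x y : f (x + y) = f x + f y.
  by apply: (@intr_inj rat); rewrite rmorphD /= !fP pairingDl.
have wD x y : w (x + y) = w x + w y.
  by rewrite /w fD mulrzDr opprD addrACA.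
have f0 : f 0 = 0 by apply: (addrI (f 0)); rewrite -fD !addr0.
have w0 : w 0 = 0 by rewrite /w f0 mulr0z subr0.
have wB : zmod_morphism w.
  by move=> x y; apply: (addIr (w y)); rewrite -wD !subrK.
have wK : involutive w.
  move=> b; rewrite {1}/w.
  have -> : f (w b) = - f b.
    have fB : zmod_morphism f.
      by move=> x y; apply: (addIr (f y)); rewrite -fD !subrK.
    pose g : {additive A -> int} :=
      HB.pack f (GRing.isZmodMorphism.Build A int f fB).
    rewrite -[f (w b)]/(g (w b)) raddfB raddfMz /= -mulrzl mulrC intz.
    have [aa0 | aaN0] := eqVneq (form a a) 0.
      suff -> : f b = 0 by rewrite mulr0 addr0 oppr0.
      by apply: (@intr_inj rat); rewrite fP /pairing aa0 eqxx.
    have -> : f a = 2.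
      by apply: (@intr_inj rat); rewrite fP /pairing aaN0 mulfK.
    by rewrite mulr_natl mulr2n opprD addrA subrr sub0r.
  by rewrite /w mulrNz opprK subrK.
have wP : w \in is_aut A by apply/mem_set; split=> //; exists w.
apply: (@xgetPex _ 1%g (reflection_spec a)); exists (Aut wP) => b.
by exists (f b).
Qed.

Definition weyl_set P : set (aut A) := gen (reflection @` P).
Definition weyl_group P : groupType := gen_group (reflection @` P).

Definition reflectable R P : Prop :=
  P `<=` nonisotropic R /\
  [set (w : aut A) a | w in weyl_set P & a in P] = nonisotropic R.

Definition alternating e (s : seq A) : Prop :=
  ~~ odd (size s) /\
  \sum_(j < size s)
     rad_part e (nth 0 s j) *~ ((-1) ^+ j.+1 * sgn e (nth 0 s j)) = 0.

(* The words x_{a_1} ... x_{a_k} in the letters x_a, a in P, such that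
   (a_1, ..., a_k) is an alternating tuple in P. *)
Definition alt_relators e P : set (word P) :=
  [set [seq (x, false) | x <- s] | s in
     [set s : seq P | alternating e [seq \val x | x <- s]]].

End AffineReflectionSystem.

Arguments alt_relators {A} form e P.

(* If A is allowed elements of order 2, the presentation of the Weyl group by
   alternating tuples fails in type A_1.  For roots a, b of sign 1, w_a w_b maps e
   to e + 2 (p(a) - p(b)), so an even product of reflections is 1 as soon as
   twice the alternating sum vanishes.  For instance, let A = Z e + (Z/2) s,
   S = {0, s} and R = {0, s, +-e, +-e + s}: then w_e = w_(e+s) and the Weyl group
   has order 2, but for the reflectable set {e, e + s} the presented group is
   the Klein four-group. *)
Definition two_torsion_free (A : zmodType) : Prop :=
  forall a : A, a *+ 2 = 0 -> a = 0.

(* Main.v *)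
Require Import Defs.
From HB Require Import structures.
From mathcomp Require Import all_boot all_order all_algebra.
From mathcomp Require Import boolp classical_sets.
From mathcomp Require Import ring.

Set Implicit Arguments.
Unset Strict Implicit.
Unset Printing Implicit Defensive.

Import Order.TTheory GRing.Theory Num.Theory.

Local Open Scope classical_set_scope.
Local Open Scope ring_scope.

(* Write w_a for the reflection of a.  In type A_1 a product of k reflections
   w_(a_1) ... w_(a_k) acts on A by
     b |-> (-1)^k sgn(b) eps + p(b) - 2 (-1)^k sgn(b) sigma,
   where sigma is the alternating sum of the sgn(a_j) p(a_j).  Since eps has
   infinite order modulo the radical and A has no 2-torsion, the product is 1 iff
   k is even and sigma = 0, that is, iff (a_1, ..., a_k) is alternating.  The
   tuples (a, a) are alternating, so in the presented group every word equals a
   positive one, and therefore evaluation at the reflections is injective.  It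
   is onto the Weyl group because w_(w a) = w w_a w^-1 and Pi is reflectable. *)

(** * Subgroups generated by a set *)

Section Generated.
Variable G : groupType.
Implicit Types B H : set G.

Lemma sub_gen B : B `<=` gen B.
Proof. by move=> g Bg H [_]; apply. Qed.

Lemma gen_sub B H : group_closed [in H] -> B `<=` H -> gen B `<=` H.
Proof. by move=> Hc BH; apply: smallest_sub. Qed.

Lemma gen1 B : gen B 1%g.
Proof. by have /set_mem := (gen_group_closed B).1. Qed.

Lemma genF B g h : gen B g -> gen B h -> gen B (g / h)%g.
Proof.
by move=> /mem_set Bg /mem_set Bh; apply/set_mem/(gen_group_closed B).2.
Qed.

Lemma genV B g : gen B g -> gen B (g^-1)%g.
Proof. by move=> Bg; rewrite -div1g; apply: genF => //; apply: gen1. Qed.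

Lemma genM B g h : gen B g -> gen B h -> gen B (g * h)%g.
Proof. by move=> Bg Bh; rewrite -[h]invgK; apply: genF => //; apply: genV. Qed.

End Generated.

(** * Evaluation of words in a group *)

Section WordEval.
Variables (G : groupType) (X : Type) (x : X -> G).
Implicit Types (u v : word X).

Definition letter_eval (c : X * bool) : G :=
  if c.2 then ((x c.1)^-1)%g else x c.1.

Definition word_eval u : G := (\prod_(c <- u) letter_eval c)%g.

Lemma word_eval_cat u v : word_eval (u ++ v) = (word_eval u * word_eval v)%g.
Proof. exact: big_cat. Qed.

Lemma word_eval_inv u : word_eval (word_inv u) = ((word_eval u)^-1)%g.
Proof.
elim: u => [|c u IHu]; first by rewrite /word_eval big_nil invg1.
rewrite /word_inv /= rev_cons -cats1 word_eval_cat -/(word_inv u) IHu.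
rewrite /word_eval big_seq1 big_cons invgM; congr (_ * _)%g.
by case: c => y [] //=; rewrite /letter_eval /= invgK.
Qed.

(** Each rule generating [word_eqv] preserves values, so evaluation descends to the presented
    group. *)
Lemma word_eval_sound (rels : set (word X)) u v :
  (forall r, rels r -> word_eval r = 1%g) ->
  word_eqv rels u v -> word_eval u = word_eval v.
Proof.
move=> rels1; elim=> {u v} //.
- by move=> u v w _ -> _ ->.
- by move=> u u' v v' _ IHu _ IHv; rewrite !word_eval_cat IHu IHv.
- move=> y b; rewrite /word_eval !big_cons big_nil mulg1 /letter_eval.
  by case: b => /=; rewrite (mulVg, mulgV).
- by move=> r /rels1 ->; rewrite /word_eval big_nil.
Qed.

Lemma gen_range g : gen (range x) g <-> exists u, word_eval u = g.
Proof.
split=> [|[u <-]]; last first.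
  elim: u => [|c u IHu]; first by rewrite /word_eval big_nil; apply: gen1.
  rewrite /word_eval big_cons; apply: genM => //.
  have xc : gen (range x) (x c.1) by apply: sub_gen; exists c.1.
  by rewrite /letter_eval; case: ifP => // _; apply: genV.
move: g; apply: (@gen_sub _ _ [set g | exists u, word_eval u = g]); last first.
  move=> _ [y _ <-]; exists [:: (y, false)].
  by rewrite /word_eval big_seq1.
split=> [|g h /set_mem[u <-] /set_mem[v <-]]; apply/mem_set.
  by exists [::]; rewrite /word_eval big_nil.
by exists (u ++ word_inv v); rewrite word_eval_cat word_eval_inv.
Qed.

End WordEval.

(** * Recognizing a group as a presented one *)

Lemma presented_piM (X : choiceType) (rels : set (word X)) u v :
  presented_pi rels (u ++ v) = (presented_pi rels u * presented_pi rels v)%g.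
Proof. by rewrite [RHS]presented_mulE. Qed.

Lemma word_eqv_div (X : choiceType) (rels : set (word X)) u v :
  word_eqv rels (u ++ word_inv v) [::] -> word_eqv rels u v.
Proof.
(* Insert v^-1 v, which is equivalent to the empty word, after u. *)
move=> uv; apply: (@word_eqv_trans _ _ _ (u ++ word_inv v ++ v)).
  rewrite -{1}[u]cats0; apply: word_eqv_cat; first exact: word_eqv_refl.
  apply: word_eqv_sym; rewrite -{2}[v]word_invK; exact: word_eqv_mulV.
rewrite catA -{3}[v]cat0s; apply: word_eqv_cat => //; exact: word_eqv_refl.
Qed.

(** Send an element to the class of a chosen word with that value. The kernel condition makes words
    of equal value equivalent, so the choice does not matter and the map is multiplicative. *)
Lemma isomorphic_presented (G : groupType) (B : set G) (X : choiceType)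
    (rels : set (word X)) (x : X -> G) :
  gen B = gen (range x) ->
  (forall r, rels r -> word_eval x r = 1%g) ->
  (forall u, word_eval x u = 1%g -> word_eqv rels u [::]) ->
  isomorphic (gen_group B) (presented rels).
Proof.
move=> Bx rels1 ker.
have inj u v : word_eval x u = word_eval x v -> word_eqv rels u v.
  move=> uv; apply/word_eqv_div/ker.
  by rewrite word_eval_cat word_eval_inv uv mulgV.
have surj (g : gen_group B) : exists u, word_eval x u = val g.
  by apply/gen_range; rewrite -Bx; apply/set_mem/gen_valP.
have [f fE] := choice surj.
pose F g := presented_pi rels (f g).
have FM : {morph F : g h / (g * h)%g}.
  move=> g h; rewrite /F -presented_piM; apply/presented_piP/inj.
  by rewrite word_eval_cat !fE valM.
pose F' : {multiplicative gen_group B -> presented rels} :=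
  HB.pack F (isMultiplicative.Build _ _ F FM).
exists F'.
have memB u : word_eval x u \in gen B.
  by apply/mem_set; rewrite Bx; apply/gen_range; exists u.
(* The inverse evaluates a representative word: soundness of evaluation gives one cancellation, its
   injectivity modulo [rels] the other. *)
exists (fun p => GenGroup (memB (repr p))) => [g | p].
  apply: val_inj => /=; rewrite -fE.
  exact: word_eval_sound rels1 (presented_repr_pi _ _).
rewrite -[RHS]presented_reprK; apply/presented_piP/inj.
by rewrite fE.
Qed.

(** As y y is a relator, the letter y^-1 can be replaced by y. *)
Lemma word_eqv_positive (X : choiceType) (rels : set (word X)) :
  (forall y, rels [:: (y, false); (y, false)]) ->
  forall u, word_eqv rels u [seq (c.1, false) | c <- u].
Proof.
move=> sq; elim=> [|[y b] u IHu]; first exact: word_eqv_refl.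
rewrite -[(y, b) :: u]cat1s -[map _ _]cat1s; apply: word_eqv_cat => //=.
case: b; last exact: word_eqv_refl.
by apply/word_eqv_sym/word_eqv_div/word_eqv_rel; apply: sq.
Qed.

(** * Reflections as isometries, and their conjugates *)

Section Isometries.
Variables (A : zmodType) (form : A -> A -> rat).
Hypothesis form_psd : psd_form form.
Implicit Types (a b c : A) (w : aut A).

(** Fixing the second argument makes the lemmas on additive maps available for the form; symmetry
    carries them to the other argument. *)
Definition form_l b a := form a b.

Lemma form_l_zmod_morphism b : zmod_morphism (form_l b).
Proof.
move=> x y; apply: (addIr (form_l b y)).
by rewrite /form_l -(form_addl form_psd) !subrK.
Qed.

HB.instance Definition _ b :=
  GRing.isZmodMorphism.Build A rat (form_l b) (form_l_zmod_morphism b).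

Lemma formBl a a' b : form (a - a') b = form a b - form a' b.
Proof. exact: (raddfB (form_l b)). Qed.

Lemma formMzl a b n : form (a *~ n) b = n%:~R * form a b.
Proof. by rewrite mulrzl; exact: (raddfMz (form_l b)). Qed.

Lemma formBr a b b' : form a (b - b') = form a b - form a b'.
Proof. by rewrite !(form_sym form_psd a) formBl. Qed.

Lemma formMzr a b n : form a (b *~ n) = n%:~R * form a b.
Proof. by rewrite !(form_sym form_psd a) formMzl. Qed.

Definition isometry : set (aut A) :=
  [set w | forall b c, form (w b) (w c) = form b c].

Lemma isometry_group_closed : group_closed [in isometry].
Proof.
split=> [|g h /set_mem gi /set_mem hi]; apply/mem_set => // b c.
rewrite /= gi -[in RHS](_ : (h * h^-1)%g b = b); last by rewrite mulgV.
by rewrite -[in RHS](_ : (h * h^-1)%g c = c) ?hi // mulgV.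
Qed.

Lemma reflection_spec_isometry a w : reflection_spec form a w -> isometry w.
Proof.
move=> wP b c; have [n nE ->] := wP b; have [m mE ->] := wP c.
rewrite formBl !formBr !formMzl !formMzr nE mE /pairing.
have [aa0 | aaN0] := eqVneq (form a a) 0; first by rewrite !mul0r !subr0.
by rewrite (form_sym form_psd a c) /=; field.
Qed.

Lemma reflection_spec_unique a w w' :
  reflection_spec form a w -> reflection_spec form a w' -> w = w'.
Proof.
move=> wP w'P; apply: autP => b; have [n nE ->] := wP b.
have [m mE ->] := w'P b; congr (_ - _ *~ _).
by apply: (@intr_inj rat); rewrite nE mE.
Qed.

(** As [w] preserves the form, b pairs with [w a] as w^-1 b pairs with [a]. *)
Lemma reflection_spec_conj a w r : isometry w ->
  reflection_spec form a r -> reflection_spec form (w a) (w * r / w)%g.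
Proof.
move=> wi rP b; have [n nE rE] := rP ((w^-1)%g b); exists n.
  rewrite nE /pairing -(wi a) -(wi _ a).
  by rewrite (_ : w ((w^-1)%g b) = b) // -[LHS]/((w * w^-1)%g b) mulgV.
rewrite -[LHS]/(w (r ((w^-1)%g b))) rE raddfB raddfMz.
by congr (_ - _); rewrite -[LHS]/((w * w^-1)%g b) mulgV.
Qed.

(** The pairing with [a] is 0 by convention, so the identity meets the specification, which has only
    one solution. *)
Lemma reflection_isotropic a : form a a = 0 -> reflection form a = 1%g.
Proof.
move=> aa0; have one : reflection_spec form a 1%g.
  by move=> b; exists 0; rewrite ?mulr0z ?subr0 // /pairing aa0 eqxx.
exact: reflection_spec_unique (xgetI 1%g one) one.
Qed.

Variables (R : set A).
Hypothesis R_ars : affine_reflection_system form R.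

(** A root outside the radical is [w b] with [w] in the group of [P] and [b] in [P], so its
    reflection is a conjugate of that of [b]; roots in the radical reflect trivially. *)
Lemma weyl_set_reflectable (P : set A) : reflectable form R P ->
  weyl_set form R = weyl_set form P.
Proof.
move=> [PR PE]; have P_sub a : P a -> R a by move=> /PR[].
apply/seteqP; split; apply: gen_sub; try exact: gen_group_closed.
  move=> _ [a Ra <-]; have [arad | aX] := EM (radical form a).
    by rewrite reflection_isotropic //; apply: gen1.
  have : nonisotropic form R a by [].
  rewrite -PE => -[w Pw [b Pb wb]].
  (* The isometries form a subgroup containing the generating reflections. *)
  have wi : isometry w.
    apply: (@gen_sub _ _ isometry _ _ _ Pw); first exact: isometry_group_closed.
    move=> _ [c /P_sub Rc <-].
    exact: reflection_spec_isometry (reflection_root form_psd R_ars Rc).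
  have -> : reflection form a = (w * reflection form b / w)%g.
    apply: reflection_spec_unique (reflection_root form_psd R_ars Ra) _.
    rewrite -wb; apply: reflection_spec_conj => //.
    exact: reflection_root form_psd R_ars (P_sub _ Pb).
  by apply: genF => //; apply: genM => //; apply: sub_gen; exists b.
by move=> _ [a /P_sub Ra <-]; apply: sub_gen; exists a.
Qed.

End Isometries.

(** * Coordinates and products of reflections in type A_1 *)

Section TypeA1.
Variables (A : zmodType) (form : A -> A -> rat) (R : set A) (e : A) (S : set A).
Hypothesis form_psd : psd_form form.
Hypothesis R_ars : affine_reflection_system form R.
Hypothesis R_S : A1_realization form R e S.
Hypothesis e_norm : form e e = 2.
Implicit Types (a b c p : A) (s : seq A).

Local Notation radical := (radical form).
Local Notation sgn := (sgn form e).
Local Notation rad_part := (rad_part form e).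

Lemma radicalB p q : radical p -> radical q -> radical (p - q).
Proof. by move=> p0 q0 b; rewrite formBl // p0 q0 subrr. Qed.

Lemma radicalMz p n : radical p -> radical (p *~ n).
Proof. by move=> p0 b; rewrite formMzl // p0 mulr0. Qed.

Lemma radicalD p q : radical p -> radical q -> radical (p + q).
Proof. by move=> p0 q0 b; rewrite (form_addl form_psd) p0 q0 addr0. Qed.

Lemma radical0 : radical 0.
Proof. by move=> b; rewrite -(subrr e) formBl // subrr. Qed.

(** [A1_direct] provides a decomposition, so [xget] returns a genuine one and not its default. *)
Lemma coordsP a : radical (rad_part a) /\ a = e *~ sgn a + rad_part a.
Proof.
have [np [npP _]] := A1_direct R_S a.
pose P := [set np : int * A | radical np.2 /\ a = e *~ np.1 + np.2].
exact: (@xgetI _ (0, 0) P np npP).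
Qed.

Lemma rad_partP a : radical (rad_part a). Proof. exact: (coordsP a).1. Qed.

Lemma coordsE a : a = e *~ sgn a + rad_part a. Proof. exact: (coordsP a).2. Qed.

Lemma coords_uniq n m p q : radical p -> radical q ->
  e *~ n + p = e *~ m + q -> n = m /\ p = q.
Proof.
move=> pr qr E; have [np [_ uniq]] := A1_direct R_S (e *~ n + p).
have npE : np = (n, p) by apply: uniq.
have : np = (m, q) by apply: uniq.
by rewrite npE => -[].
Qed.

Lemma coords_add n p : radical p ->
  sgn (e *~ n + p) = n /\ rad_part (e *~ n + p) = p.
Proof.
by move=> pr; apply: coords_uniq (rad_partP _) pr _; rewrite -coordsE.
Qed.

Lemma form_sgn a b : form a b = 2 * (sgn a * sgn b)%:~R.
Proof.
rewrite [in LHS](coordsE a) [in LHS](coordsE b).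
rewrite (form_addl form_psd) (rad_partP a) addr0 (form_addr form_psd).
rewrite [form _ (rad_part b)](form_sym form_psd) (rad_partP b) addr0.
by rewrite formMzl // formMzr // e_norm rmorphM /=; ring.
Qed.

(** Roots in S + S or 0 + S lie in the radical; the others have the form e + s or - e + s. *)
Lemma sgn_nonisotropic a : nonisotropic form R a -> sgn a * sgn a = 1.
Proof.
have Sr t : S t -> radical t by move=> /(A1_sub R_S)[].
move=> [Ra arad]; move: Ra; rewrite (A1_roots R_S) => -[].
  move=> [t St [t' St' tt']]; case: arad; rewrite -tt'.
  by apply: radicalD; apply: Sr.
have sgnE n t : radical t -> sgn (e *~ n + t) = n by case/(coords_add n).
move=> [r r_dot [t /Sr St tE]]; rewrite -tE in arad *.
case: r_dot arad => [[->|->]|->] arad.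
- by case: arad; rewrite add0r.
- by rewrite -[e]mulr1z sgnE.
- by rewrite -[- e]/(e *~ -1) sgnE.
Qed.

Lemma reflection_sgn a b : nonisotropic form R a ->
  reflection form a b = b - a *~ (2 * (sgn a * sgn b)).
Proof.
move=> aX; have [n nE ->] := reflection_root form_psd R_ars aX.1 b.
congr (_ - _ *~ _); apply: (@intr_inj rat); rewrite nE /pairing.
have aa : form a a = 2 by rewrite form_sgn sgn_nonisotropic // mulr1.
by rewrite aa /= form_sgn !rmorphM /=; field.
Qed.

(** The sum in [alternating]; the exponent [j.+1] gives the first entry the sign -1. *)
Definition alt_sum s : A :=
  \sum_(j < size s)
     rad_part (nth 0 s j) *~ ((-1) ^+ j.+1 * sgn (nth 0 s j)).

Lemma alt_sum_cons a s : alt_sum (a :: s) = - (rad_part a *~ sgn a) - alt_sum s.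
Proof.
rewrite /alt_sum /= big_ord_recl /= expr1 mulN1r mulrNz; congr (_ + _).
rewrite -sumrN; apply: eq_bigr => j _.
by rewrite /= exprS mulN1r mulNr mulrNz.
Qed.

Lemma alt_sum_radical s : radical (alt_sum s).
Proof.
elim: s => [|a s IHs]; first by rewrite /alt_sum big_ord0; apply: radical0.
rewrite alt_sum_cons; apply: radicalB => //.
by rewrite -mulrNz; apply/radicalMz/rad_partP.
Qed.

(** Induction on [s]: the reflection in the head [a] negates the coefficient m of [e] produced by
    the tail and adds -2 m sgn(a) p(a) to the radical part, which matches the recursion for
    [alt_sum]. *)
Lemma prod_reflection s b : (forall a, a \in s -> nonisotropic form R a) ->
  (\prod_(a <- s) reflection form a)%g b =
  e *~ ((-1) ^+ size s * sgn b)
  + (rad_part b - alt_sum s *~ (2 * ((-1) ^+ size s * sgn b))).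
Proof.
elim: s => [|a s IHs] sX.
  by rewrite big_nil /alt_sum big_ord0 mul1r mul0rz subr0 -coordsE.
have aX : nonisotropic form R a by apply: sX; rewrite mem_head.
rewrite big_cons -[LHS]/(reflection form a (_ b)) reflection_sgn //.
rewrite IHs => [|c cs]; last by apply: sX; rewrite inE cs orbT.
set m := (-1) ^+ size s * sgn b.
have -> : sgn (e *~ m + (rad_part b - alt_sum s *~ (2 * m))) = m.
  apply: (coords_add m _).1.
  by apply: radicalB; [apply: rad_partP | apply/radicalMz/alt_sum_radical].
rewrite {1}(coordsE a) alt_sum_cons /= exprS mulN1r mulNr -/m.
rewrite mulrzDl -!mulrzA.
(* Since sgn(a)^2 = 1, the coefficient of [e] becomes m - 2 m = -m. *)
have -> : sgn a * (2 * (sgn a * m)) = 2 * m.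
  by rewrite mulrCA (mulrA (sgn a)) (sgn_nonisotropic aX) mul1r.
have -> : 2 * (sgn a * m) = sgn a * (2 * m) by rewrite mulrCA.
rewrite mulrN !mulrNz opprK mulrzDl !mulNrz -mulrzA.
rewrite opprD addrACA -mulrzBr -[- (e *~ m)]mulrNz; congr (_ *~ _ + _).
  by rewrite mulr_natl mulr2n opprD addrA subrr sub0r.
by rewrite addrAC addrA.
Qed.

Hypothesis A_tors : two_torsion_free A.

Lemma prod_reflection_eq1 s : (forall a, a \in s -> nonisotropic form R a) ->
  (\prod_(a <- s) reflection form a)%g = 1%g <-> alternating form e s.
Proof.
move=> sX; rewrite /alternating -/(alt_sum s); split=> [s1 | [s_even s0]].
  (* Evaluate at [e], whose coordinates are 1 and 0: the coefficients force an even length, the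
     radical parts then give twice [alt_sum s] equal to 0. *)
  have e_coords := coords_add 1 radical0; rewrite addr0 mulr1z in e_coords.
  have := prod_reflection e sX; rewrite s1 e_coords.1 e_coords.2 mulr1 sub0r.
  rewrite -[LHS]/e -{1}[e]mulr1z -{1}[e *~ 1]addr0 -mulrNz => E.
  have [] := coords_uniq radical0 (radicalMz _ (alt_sum_radical s)) E.
  rewrite -signr_odd; case: (odd (size s)) => //= _.
  rewrite mulr1 mulrNz => /esym/eqP; rewrite oppr_eq0 => /eqP s0.
  (* Here the factor 2 is removed by the absence of 2-torsion. *)
  by split=> //; apply: A_tors.
apply: autP => b; rewrite prod_reflection // s0 mul0rz subr0 -signr_odd.
by rewrite (negbTE s_even) mul1r -coordsE.
Qed.

End TypeA1.

Theorem theorem2p10 (A : zmodType) (form : A -> A -> rat) (R : set A)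
    (form_psd : psd_form form)
    (R_ars : affine_reflection_system form R)
    (R_irr : irreducible form R)
    (R_tame : tame form R)
    (R_A1 : type_A1 form R)
    (eps : A) (S : set A)
    (R_S : A1_realization form R eps S)
    (eps_norm : form eps eps = 2)
    (A_tors : two_torsion_free A)
    (Pi : set A)
    (Pi_refl : reflectable form R Pi) :
  isomorphic (weyl_group form R) (presented (alt_relators form eps Pi)).
Proof.
have PiX (s : seq Pi) a : a \in [seq \val x | x <- s] -> nonisotropic form R a.
  by move=> /mapP[x _ ->]; apply/Pi_refl.1/set_valP.
have prodE := prod_reflection_eq1 form_psd R_ars R_S eps_norm A_tors (PiX _).
pose x (a : Pi) := reflection form (\val a).
have evalE (s : seq Pi) : word_eval x [seq (a, false) | a <- s] =
    (\prod_(a <- [seq \val a | a <- s]) reflection form a)%g.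
  by rewrite /word_eval !big_map.
have rels1 r : alt_relators form eps Pi r -> word_eval x r = 1%g.
  by move=> [s /prodE s1 <-]; rewrite evalE.
apply: (isomorphic_presented (x := x)) => // [|u u1].
  (* Reflectability cuts the generators down to [Pi]; what remains is to index them by the
     subtype. *)
  rewrite -/(weyl_set form R) (weyl_set_reflectable form_psd R_ars Pi_refl).
  congr gen; apply/seteqP; split=> [_ [a Pia <-] | _ [a _ <-]].
    by exists (SigSub (mem_set Pia)).
  by exists (\val a) => //; apply: set_valP.
(* The two terms of the alternating sum of (a, a) cancel. *)
have sq (a : Pi) : alt_relators form eps Pi [:: (a, false); (a, false)].
  exists [:: a; a] => //; split=> //.
  rewrite /= !big_ord_recl big_ord0 addr0 expr1 mulN1r mulrNz.
  by rewrite sqrrN expr1n mul1r addNr.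
(* Dropping the inverses keeps the class of [u], hence its value 1, so the positive word obtained is
   itself a relator. *)
have upos := word_eqv_positive sq u.
apply: (word_eqv_trans upos); apply: word_eqv_rel.
have uE : [seq (c.1, false) | c <- u] =
    [seq (a, false) | a <- [seq c.1 | c <- u]].
  by rewrite -map_comp.
rewrite uE; exists [seq c.1 | c <- u] => //; apply/prodE.
by rewrite -evalE -uE -(word_eval_sound rels1 upos).
Qed.
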